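(* Let $G\in\mathcal{G}(n)$. For any computation schedule evaluating $G$ in the two-level memory model with a cache of $M$ words and block size $B\ge 1$, where recomputation of values is allowed, the number of I/O operations is at least $$IO_G(n,M,B)\ \ge\ \max\left\{\frac{(n-6M-1)^3}{18\sqrt{M}}-2M,\ n\right\}\frac{1}{B}.$$
   Context: For a positive integer $n$, the family $\mathcal{G}(n)$ consists of all CDAGs (computational DAGs) built as follows. There are $R$-vertices $v_{i,j}$ for all $1\le i\le j\le n$; the vertices $v_{i,i}$ are the input vertices. For every pair $i<j$ the CDAG contains a directed binary tree with exactly $j-i$ leaves, all of whose edges are directed towards its root $v_{i,j}$; the shape of each tree is arbitrary and trees for distinct pairs are vertex-disjoint. For $k\in\{0,\dots,j-i-1\}$ the $k$-th leaf of the tree rooted at $v_{i,j}$ has exactly two predecessors, $v_{i,i+k}$ and $v_{i+k+1,j}$. Memory model: a cache of $M$ words and a slow memory of unbounded size; each vertex value occupies one word; the value of a vertex can be computed only when the values of all its predecessors are in the cache, and the result is placed in the cache; the inputs are initially only in slow memory; a read (resp. write) I/O operation moves up to $B$ words stored in consecutive locations from slow memory to cache (resp. from cache to slow memory). A computation schedule evaluates all vertices of $G$, possibly computing some values more than once; $IO_G(n,M,B)$ is the minimum number of I/O operations over all such schedules. Standing assumption: $n=2^a$ and $M=2^b$ for integers $a,b\ge 3$. *)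

(* Defs.v *)
From HB Require Import structures.
From mathcomp Require Import all_boot all_order all_algebra.
From mathcomp Require Import all_classical all_reals all_analysis.
Set Implicit Arguments.
Unset Strict Implicit.
Unset Printing Implicit Defensive.
Import Order.TTheory GRing.Theory Num.Theory.

(* [edge u w] means that [u] is a predecessor of [w]. *)
Record cdag := Cdag {
  vertex :> finType;
  edge : rel vertex;
  cdag_acyclic : forall u w : vertex, edge u w -> ~~ connect edge w u
}.

Definition preds (G : cdag) (w : G) : {set G} := [set u | edge u w].

Definition is_input (G : cdag) (u : G) : bool := preds u == finset.set0.

Section Trees.
Variables (G : cdag) (T : {set G}).

Definition tree_edge : rel G := [rel u w | [&& u \in T, w \in T & edge u w]].

Definition is_leaf (u : G) : bool :=
  (u \in T) && [forall w, ~~ tree_edge w u].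

(* [T] induces a binary tree with all edges directed towards its root [r].
   A vertex may have zero, one or two children. *)
Record binary_tree (r : G) : Prop := BinaryTree {
  bt_root : r \in T;
  bt_root_out : forall w, ~~ tree_edge r w;
  bt_parent : forall u, u \in T -> u != r -> #|[set w | tree_edge u w]| = 1;
  bt_connect : forall u, u \in T -> connect tree_edge u r;
  bt_binary : forall u, u \in T -> #|[set w | tree_edge w u]| <= 2
}.

End Trees.

(* Indices are those of the mathematical text, 1 <= i <= j <= n; the values of
   [v], [T] and [leaf] outside the ranges used below are irrelevant. *)
Record family_labelling (n : nat) (G : cdag) (v : nat -> nat -> G)
    (T : nat -> nat -> {set G}) (leaf : nat -> nat -> nat -> G) : Prop :=
  FamilyLabelling {
  fl_input : forall u : G,
    is_input u <-> exists2 i, 1 <= i <= n & u = v i i;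
  fl_input_inj : forall i j, 1 <= i <= n -> 1 <= j <= n ->
    v i i = v j j -> i = j;
  fl_tree : forall i j, 1 <= i -> i < j -> j <= n ->
    binary_tree (T i j) (v i j);
  fl_cover : forall u : G, ~~ is_input u ->
    exists i j, [/\ 1 <= i, i < j, j <= n & u \in T i j];
  fl_tree_input : forall i j u, 1 <= i -> i < j -> j <= n ->
    u \in T i j -> ~~ is_input u;
  fl_disjoint : forall i j i' j',
    1 <= i -> i < j -> j <= n -> 1 <= i' -> i' < j' -> j' <= n ->
    (i, j) <> (i', j') -> [disjoint T i j & T i' j'];
  fl_leaf : forall i j u, 1 <= i -> i < j -> j <= n ->
    is_leaf (T i j) u <-> exists2 k, k < j - i & u = leaf i j k;
  fl_leaf_inj : forall i j k k', 1 <= i -> i < j -> j <= n ->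
    k < j - i -> k' < j - i -> leaf i j k = leaf i j k' -> k = k';
  fl_leaf_preds : forall i j k, 1 <= i -> i < j -> j <= n -> k < j - i ->
    preds (leaf i j k) = [set v i (i + k); v (i + k + 1) j]%SET;
  fl_node_preds : forall i j u, 1 <= i -> i < j -> j <= n ->
    u \in T i j -> ~~ is_leaf (T i j) u -> preds u \subset T i j
}.

Definition in_family (n : nat) (G : cdag) : Prop :=
  exists v T leaf, @family_labelling n G v T leaf.

Section Memory.
Variable G : cdag.

Definition slow_memory := nat -> option G.

Record state := State { cache : {set G}; slow : slow_memory }.

(* [Read a l] transfers the [l] locations a, ..., a + l - 1 to the cache;
   [Write a ws] transfers the values [ws] to consecutive locations from [a];
   [Discard] frees a cache word at no cost. *)
Inductive op :=
| Compute of G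
| Read of nat & nat
| Write of nat & seq G
| Discard of G.

Definition effect (s : state) (o : op) : state :=
  match o with
  | Compute u => State (u |: cache s)%SET (slow s)
  | Read a l =>
      State (cache s :|: [set u | has (fun x => slow s x == Some u) (iota a l)])
            (slow s)
  | Write a ws =>
      State (cache s)
            (fun x => if a <= x < a + size ws then onth ws (x - a)
                      else slow s x)
  | Discard u => State (cache s :\ u)%SET (slow s)
  end.

Definition legal (M B : nat) (s : state) (o : op) : bool :=
  match o with
  | Compute u => ~~ is_input u && (preds u \subset cache s)
  | Read _ l => l <= B
  | Write _ ws => (size ws <= B) && all (fun u => u \in cache s) ws
  | Discard _ => true
  end && (#|cache (effect s o)| <= M).

Fixpoint legal_run (M B : nat) (s : state) (ops : seq op) : bool :=
  if ops is o :: ops' then legal M B s o && legal_run M B (effect s o) ops'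
  else true.

(* Slow memory initially holds all the inputs, and nothing else, in an
   arbitrary layout. *)
Definition initial_layout (mem0 : slow_memory) : Prop :=
  (forall x u, mem0 x = Some u -> is_input u) /\
  (forall u, is_input u -> exists x, mem0 x = Some u).

Definition computed (ops : seq op) : seq G :=
  pmap (fun o => if o is Compute u then Some u else None) ops.

Definition is_schedule (M B : nat) (mem0 : slow_memory) (ops : seq op) : Prop :=
  [/\ initial_layout mem0,
      legal_run M B (State finset.set0 mem0) ops
    & forall u : G, ~~ is_input u -> u \in computed ops].

Definition is_io (o : op) : bool :=
  match o with Read _ _ | Write _ _ => true | _ => false end.

Definition io_count (ops : seq op) : nat := count is_io ops.

End Memory.

(* The infimum of a set of natural numbers is its minimum, unless the set is
   empty, in which case it is +oo. *)
Definition IO (R : realType) (G : cdag) (M B : nat) : \bar R :=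
  ereal_inf [set x : \bar R | exists mem0 ops,
    @is_schedule G M B mem0 ops /\ x = ((io_count ops)%:R%:E)%R]%classic.

(* Main.v *)
(* Simulate a schedule by a pebble game whose moves transfer single words, so
   that at most B words are moved per I/O operation, and cut the game into
   segments with at most 2M transfers. Let D be the cache at the start of a
   segment together with the values loaded during it; |D| <= 3M. If v_{i,j}
   with j - i >= 3M is available in the segment, then its tree meets D: otherwise
   all the v_{l,j}, i <= l <= j, would be available, each at the price of a
   distinct element of D. So at most 3M wide pairs are available, recomputed or
   not.

   Attribute each leaf to the last moment at which its root has not been computed
   and no vertex on the path from the leaf to the root is in memory. That moment
   is a computation of the leaf, and at the end of the segment either the root
   has been computed (so the tree meets D) or its tree has a vertex in the cache or
   among the values stored in the segment: at most 4M trees are concerned.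

   If a_m and b_m count the available pairs (i, m) and (m + 1, j), at most
   min(4M, a_m b_m) <= sqrt M (a_m + b_m) leaves are attributed to a segment for
   each m, that is 6 M sqrt M in total, out of at least (n - 6M - 1)^3 / 6
   leaves both of whose predecessors are wide. The bound n counts the inputs,
   each of which must be loaded. *)

Require Import Defs.
From HB Require Import structures.
From mathcomp Require Import all_boot all_order all_algebra.
From mathcomp Require Import all_classical all_reals all_analysis.
From mathcomp Require Import zify ring lra.
Import Order.TTheory GRing.Theory Num.Theory.
Set Implicit Arguments.
Unset Strict Implicit.
Unset Printing Implicit Defensive.

(** * Counting tools *)

(** Choosing a witness in [Q] for each element of [P] is injective, as a witness determines its
    element. Trees will be charged in this way to one of their vertices, and disjointness of the
    trees gives the second hypothesis. *)
Lemma leq_card_rel (I J : finType) (P : {set I}) (Q : {set J})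
    (r : I -> J -> Prop) :
  (forall p, p \in P -> exists2 d, d \in Q & r p d) ->
  (forall p p' d, r p d -> r p' d -> p = p') -> #|P| <= #|Q|.
Proof.
move=> ex_r inj_r.
pose f p := [pick d | (d \in Q) && `[< r p d >]].
have fP p : p \in P -> exists2 d, f p = Some d & d \in Q /\ r p d.
  move=> /ex_r [d dQ rd]; rewrite /f; case: pickP => [d' /andP[d'Q /asboolP rd']|].
    by exists d'.
  by move=> /(_ d); rewrite dQ; case: asboolP.
have f_inj : {in P &, injective f}.
  move=> p p' /fP[d -> [_ rd]] /fP[d' -> [_ rd']] [dd'].
  by apply: inj_r rd _; rewrite dd'.
rewrite -(card_in_imset f_inj) -(card_imset Q (@Some_inj _)).
apply: subset_leq_card; apply/fintype.subsetP => x /imsetP[p /fP[d fd [dQ _]] ->].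
by rewrite fd imset_f.
Qed.

Lemma card_pairs_sum (I J : finType) (f : I -> J -> bool) :
  #|[set p : I * J | f p.1 p.2]%SET| = \sum_j #|[set i | f i j]%SET|.
Proof.
rewrite -sum1dep_card.
rewrite -(pair_big_dep xpredT f (fun _ _ => 1)) /= (exchange_big_dep xpredT) //=.
by apply: eq_bigr => j _; rewrite sum1dep_card.
Qed.

(** * The single-word pebble game and its simulation of schedules *)

Section Game.
Variable G : cdag.

Inductive move := Comp of G | Fetch of G | Store of G | Drop of G.

(* A configuration is the pair (cache contents, slow memory contents); unlike
   in the memory model, slow memory is never overwritten. *)
Definition config := ({set G} * {set G})%type.

Definition step (c : config) (m : move) : config :=
  match m with
  | Comp u | Fetch u => (u |: c.1, c.2)%SET
  | Store u => (c.1, u |: c.2)%SET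
  | Drop u => (c.1 :\ u, c.2)%SET
  end.

Definition admissible (M : nat) (c : config) (m : move) : bool :=
  match m with
  | Comp u => ~~ is_input u && (preds u \subset c.1)
  | Fetch u => u \in c.2
  | Store u => u \in c.1
  | Drop _ => true
  end && (#|(step c m).1| <= M).

Fixpoint play (M : nat) (c : config) (ms : seq move) : bool :=
  if ms is m :: ms' then admissible M c m && play M (step c m) ms' else true.

Definition comp_of m := if m is Comp u then Some u else None.
Definition fetch_of m := if m is Fetch u then Some u else None.
Definition store_of m := if m is Store u then Some u else None.
Definition is_transfer m :=
  match m with Fetch _ | Store _ => true | _ => false end.

Lemma play_cat M c ms ms' :
  play M c (ms ++ ms') = play M c ms && play M (foldl step c ms) ms'.
Proof. by elim: ms c => //= m ms IH c; rewrite IH andbA. Qed.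

Lemma play_fetches M (c : config) (us : seq G) :
  {subset us <= c.2} -> #|c.1 :|: [set u in us]| <= M ->
  play M c (map Fetch us) /\
  foldl step c (map Fetch us) = (c.1 :|: [set u in us], c.2)%SET.
Proof.
elim: us c => [|u us IH] [C L] /= usL cM.
  by split=> //; congr pair; apply/setP => x; rewrite !inE orbF.
have E : (u |: C :|: [set w in us] = C :|: [set w in u :: us])%SET.
  by apply/setP => x; rewrite !inE orbA; congr orb; rewrite orbC.
have [||p1 p2] := IH (u |: C, L)%SET.
- by move=> x xus /=; apply: usL; rewrite inE xus orbT.
- by rewrite /= E.
rewrite p1 p2 /= E; split=> //; rewrite andbT /admissible /= usL ?mem_head //=.
apply: leq_trans cM; apply: subset_leq_card; rewrite -E.
exact: finset.subsetUl.
Qed.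

Lemma play_stores M (c : config) (us : seq G) :
  {subset us <= c.1} -> #|c.1| <= M ->
  play M c (map Store us) /\
  foldl step c (map Store us) = (c.1, c.2 :|: [set u in us])%SET.
Proof.
elim: us c => [|u us IH] [C L] /= usC cM.
  by split=> //; congr pair; apply/setP => x; rewrite !inE orbF.
have E : (u |: L :|: [set w in us] = L :|: [set w in u :: us])%SET.
  by apply/setP => x; rewrite !inE orbA; congr orb; rewrite orbC.
have [||p1 p2] := IH (C, u |: L)%SET => //.
- by move=> x xus /=; apply: usC; rewrite inE xus orbT.
by rewrite p1 p2 /= E /admissible /= usC ?mem_head ?cM.
Qed.

Lemma size_pmap_leq (T U : Type) (f : T -> option U) s :
  size (pmap f s) <= size s.
Proof. by rewrite size_pmap count_size. Qed.

(** It is enough that [L] contain all values held in slow memory: the game never erases from it, so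
    a value overwritten in the model does no harm. An I/O operation becomes at most [B] fetches or
    stores, and the computations stay the same. *)
Lemma play_of_run M B (s : state G) (ops : seq (op G)) (L : {set G}) :
  legal_run M B s ops -> (forall x u, slow s x = Some u -> u \in L) ->
  #|cache s| <= M ->
  exists ms, [/\ play M (cache s, L) ms,
    pmap comp_of ms = computed ops
    & count is_transfer ms <= B * io_count ops].
Proof.
elim: ops s L => [|o ops IH] s L /=; first by exists [::]; rewrite /computed.
case/andP=> lo lops sL sM.
have stepM : #|cache (effect s o)| <= M by case/andP: lo.
case: o lo lops stepM => [u|a l|a ws|u].
- move=> lo /IH IHo stepM; have [|//|ms [p c t]] := IHo L; first exact: sL.
  exists (Comp u :: ms); split=> //=; first by rewrite p andbT.
  by rewrite c.
- move=> /andP[lB _] /IH IHo stepM.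
  have [|//|ms [p c t]] := IHo L; first exact: sL.
  pose us := pmap (slow s) (iota a l).
  have usE : [set u in us]%SET =
      [set u | has (fun x => slow s x == Some u) (iota a l)]%SET.
    apply/setP => u; rewrite !inE mem_pmap; apply/mapP/hasP => -[x xa].
      by move=> E; exists x => //; rewrite -E.
    by move=> /eqP xu; exists x.
  have [||q1 q2] := @play_fetches M (cache s, L) us.
  + by move=> u; rewrite mem_pmap => /mapP[x _ /esym/sL].
  + by rewrite usE.
  exists (map Fetch us ++ ms); split.
  + by rewrite play_cat q1 q2 usE.
  + by rewrite pmap_cat c; elim: (us).
  + rewrite count_cat mulnDr leq_add // muln1.
    apply: leq_trans (count_size _ _) _; rewrite size_map.
    by apply: leq_trans (size_pmap_leq _ _) _; rewrite size_iota.
- move=> /andP[/andP[lB /allP wsC] _] /IH IHo stepM.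
  have [|//|ms [p c t]] := IHo (L :|: [set u in ws])%SET.
    move=> x u /=; case: ifP => _; last by move=> /sL uL; rewrite !inE uL.
    rewrite onthE => E; rewrite !inE; apply/orP; right.
    have [lt|ge] := ltnP (x - a) (size ws).
      by move: E; rewrite (nth_map u) // => -[<-]; rewrite mem_nth.
    by move: E; rewrite nth_default // size_map.
  have [||q1 q2] := @play_stores M (cache s, L) ws; [exact: wsC|done|].
  exists (map Store ws ++ ms); split.
  + by rewrite play_cat q1 q2.
  + by rewrite pmap_cat c; elim: (ws).
  + rewrite count_cat mulnDr leq_add // muln1.
    by apply: leq_trans (count_size _ _) _; rewrite size_map.
- move=> lo /IH IHo stepM; have [|//|ms [p c t]] := IHo L; first exact: sL.
  by exists (Drop u :: ms); split=> //=; rewrite p andbT.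
Qed.

End Game.

(** * Trees of the family and the availability of their vertices *)

Section Trees.
Variables (n : nat) (G : cdag) (v : nat -> nat -> G).
Variables (T : nat -> nat -> {set G}) (leaf : nat -> nat -> nat -> G).
Hypothesis F : family_labelling n v T leaf.

Lemma tree_inj i j i' j' x : 1 <= i -> i < j -> j <= n ->
  1 <= i' -> i' < j' -> j' <= n ->
  x \in T i j -> x \in T i' j' -> (i, j) = (i', j').
Proof.
move=> i1 ij jn i1' ij' jn' xT xT'; apply: contrapT => ne.
have /pred0P/(_ x)/= := fl_disjoint F i1 ij jn i1' ij' jn' ne.
by rewrite xT xT'.
Qed.

Lemma leaf_in_tree i j k : 1 <= i -> i < j -> j <= n -> k < j - i ->
  leaf i j k \in T i j.
Proof.
move=> i1 ij jn kj.
by have /andP[] : is_leaf (T i j) (leaf i j k) by apply/(fl_leaf F) => //; exists k.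
Qed.

Lemma tree_up (A : {set G}) u x :
  u \in A -> connect (tree_edge A) u x -> x \in A.
Proof.
move=> uA /connectP[p pp ->]; elim: p u uA pp => //= w p IH u uA.
by case/andP => /and3P[_ wA _]; apply: IH.
Qed.

Lemma input_v i : 1 <= i <= n -> is_input (v i i).
Proof. by move=> i1; apply/(fl_input F); exists i. Qed.

Section Availability.
Variables D Av : {set G}.
Hypothesis avP : forall u, u \in Av -> u \notin D ->
  ~~ is_input u /\ preds u \subset Av.

Lemma input_available i : 1 <= i <= n -> v i i \in Av -> v i i \in D.
Proof.
move=> i1 iA; apply/negPn/negP => /(avP iA)[]; by rewrite input_v.
Qed.

(** Availability descends from the root: an available vertex outside [D] must have been computed, so
    its predecessors are available too. The induction runs along the path from the vertex up to the
    root. *)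
Lemma tree_available i j : 1 <= i -> i < j -> j <= n ->
  v i j \in Av -> {in T i j, forall x, x \notin D} -> T i j \subset Av.
Proof.
move=> i1 ij jn rA TD; apply/fintype.subsetP => u uT.
have /connectP[p pp pl] := bt_connect (fl_tree F i1 ij jn) uT.
rewrite {}pl in rA; elim: p u {uT} pp rA => //= w p IH u.
move=> /andP[/and3P[_ wT uw] pp] /(IH _ pp) wA.
have [_ /fintype.subsetP] := avP wA (TD _ wT); apply.
by rewrite inE.
Qed.

Lemma factors_available i j k : 1 <= i -> i < j -> j <= n -> k < j - i ->
  v i j \in Av -> {in T i j, forall x, x \notin D} ->
  v i (i + k) \in Av /\ v (i + k + 1) j \in Av.
Proof.
move=> i1 ij jn kj rA TD.
have lT := leaf_in_tree i1 ij jn kj.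
have lA := fintype.subsetP (tree_available i1 ij jn rA TD) _ lT.
have [_] := avP lA (TD _ lT).
by rewrite (fl_leaf_preds F i1 ij jn kj) finset.subUset !finset.sub1set => /andP.
Qed.

(* If [T i j] misses [D], then every [v l j] with i <= l <= j is available, and
   each of them forces an element of [D]: one in [T l j], or else the input
   [v l l]. These j - i + 1 elements are distinct. *)
Lemma wide_tree_meets i j : 1 <= i -> i < j -> j <= n -> #|D| <= j - i ->
  v i j \in Av -> exists2 x, x \in D & x \in T i j.
Proof.
move=> i1 ij jn Dij rA; apply: contrapT => noD.
have TD : {in T i j, forall x, x \notin D}.
  by move=> x xT; apply/negP => xD; apply: noD; exists x.
suff : (j - i).+1 <= #|D| by lia.
pose r (o : 'I_(j - i).+1) (d : G) :=
  d = v (i + o) (i + o) \/ i + o < j /\ d \in T (i + o) j.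
rewrite -[(j - i).+1]card_ord -cardsT; apply: (leq_card_rel (r := r)).
  move=> o _; have oij := ltn_ord o.
  have lA : v (i + o) j \in Av.
    case: (posnP o) => [->|o0]; first by rewrite addn0.
    (* The right predecessor of the leaf of index [o - 1] is [v (i + o) j]. *)
    have oj : o.-1 < j - i by lia.
    have [_] := factors_available i1 ij jn oj rA TD.
    by rewrite -addnA addn1 prednK.
  have [jl|lj] := leqP j (i + o).
    have ioj : i + o = j by lia.
    exists (v j j); last by left; rewrite ioj.
    by apply: input_available; [lia | move: lA; rewrite ioj].
  have [[x xD xT]|noDl] := pselect (exists2 x, x \in D & x \in T (i + o) j).
    by exists x => //; right.
  exists (v (i + o) (i + o)); last by left.
  apply: input_available; first lia.
  have l1 : 1 <= i + o by lia.
  have j0 : 0 < j - (i + o) by lia.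
  have TDl : {in T (i + o) j, forall x, x \notin D}.
    by move=> x xT; apply/negP => xD; apply: noDl; exists x.
  by have [] := factors_available l1 lj jn j0 lA TDl; rewrite addn0.
move=> o o' d; have oij := ltn_ord o; have oij' := ltn_ord o'.
have l1 : 1 <= i + o by lia.
have l1' : 1 <= i + o' by lia.
case=> [->|[lj dT]] [|[lj' dT']].
- by move=> /(fl_input_inj F) E; apply/val_inj => /=; move: E; lia.
- by move: (fl_tree_input F l1' lj' jn dT'); rewrite input_v //; lia.
- by move=> E; move: (fl_tree_input F l1 lj jn dT); rewrite E input_v //; lia.
- have [E] := tree_inj l1 lj jn l1' lj' jn dT dT'.
  by apply/val_inj => /=; lia.
Qed.

End Availability.
End Trees.

(** * Plays, indexed by time, and their segments *)

Section Play.
Variables (G : cdag) (x0 : G) (M : nat) (c0 : config G) (ms : seq (move G)).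
Hypothesis ms_play : play M c0 ms.

Definition move_at t := nth (Drop x0) ms t.
Definition config_at t := foldl (@step G) c0 (take t ms).
Definition transfers t := count (@is_transfer G) (take t ms).

Lemma config_atS t : t < size ms ->
  config_at t.+1 = step (config_at t) (move_at t).
Proof. by move=> lt; rewrite /config_at (take_nth (Drop x0)) // foldl_rcons. Qed.

Lemma transfersS t : t < size ms ->
  transfers t.+1 = transfers t + is_transfer (move_at t).
Proof.
move=> lt.
by rewrite /transfers (take_nth (Drop x0)) // -cats1 count_cat /= addn0.
Qed.

Lemma admissible_at t : t < size ms ->
  admissible M (config_at t) (move_at t).
Proof.
move=> lt; move: ms_play; rewrite -{1}(cat_take_drop t ms) play_cat.
by rewrite (drop_nth (Drop x0)) //= => /and3P[].
Qed.

Lemma card_cache_at t : #|c0.1| <= M -> t <= size ms -> #|(config_at t).1| <= M.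
Proof.
case: t => [|t] c0M lt; first by rewrite /config_at take0.
by rewrite config_atS //; case/andP: (admissible_at lt).
Qed.

(** A discrete intermediate value property: one move adds at most one transfer, so the least time
    with at least [k] transfers has exactly [k]. *)
Lemma transfers_onto s k : s <= size ms ->
  transfers s <= k <= transfers (size ms) ->
  exists2 e, s <= e <= size ms & transfers e = k.
Proof.
clear ms_play.
move=> ss /andP[sk kL].
have ex : exists e, (s <= e <= size ms) && (k <= transfers e).
  by exists (size ms); rewrite ss leqnn.
case: (ex_minnP ex) => e /andP[/andP[se el] ke] emin.
exists e; first by rewrite se.
have [es|lt] := leqP e s.
  have ees : e = s by lia.
  by move: ke; rewrite ees; lia.
case: e se el ke lt emin {ex} => // e se el ke lt emin.
have : ~~ (k <= transfers e).
  by apply/negP => h; have := emin e; rewrite h; lia.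
by move: ke; rewrite transfersS //; case: is_transfer; lia.
Qed.

Section Segment.
Variables s e : nat.
Hypotheses (se : s <= e) (eL : e <= size ms).

Definition segment := drop s (take e ms).

Lemma mem_segmentP (f : move G -> option G) u :
  reflect (exists2 t, s <= t < e & f (move_at t) = Some u)
          (u \in pmap f segment).
Proof.
clear ms_play.
have -> : (u \in pmap f segment) = (Some u \in map f segment).
  by elim: segment => //= m l IH; case: (f m) => [w|] /=; rewrite !inE IH.
have nthE i : i < e - s ->
    nth None (map f segment) i = f (move_at (s + i)).
  move=> ie; rewrite (nth_map (Drop x0)) ?size_drop ?size_takel //.
  by rewrite nth_drop nth_take //; lia.
have sizeE : size (map f segment) = e - s.
  by rewrite size_map size_drop size_takel.
apply: (iffP (nthP None)) => [[i]|[t te fu]].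
  rewrite sizeE => ie; rewrite nthE // => fu; exists (s + i) => //; lia.
exists (t - s); rewrite ?sizeE ?nthE; try lia.
by rewrite subnKC //; lia.
Qed.

(** The set called D in the overview; whatever else is available in the segment is computed
    there. *)
Definition sources := ((config_at s).1 :|: [set u in pmap (@fetch_of G) segment])%SET.
Definition stored := [set u in pmap (@store_of G) segment]%SET.
Definition available := (sources :|: [set u in pmap (@comp_of G) segment])%SET.

Lemma transfers_segment : transfers e = transfers s + count (@is_transfer G) segment.
Proof.
rewrite /transfers /segment -{1}(cat_take_drop s (take e ms)) count_cat.
by rewrite take_takel.
Qed.

(** A transfer is either a fetch or a store, so it enlarges only one of the two sets. Bounding them
    jointly is what later gives 3M for both together. *)
Lemma card_sources_stored :
  #|sources| + #|stored| <= #|(config_at s).1| + (transfers e - transfers s).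
Proof.
rewrite transfers_segment addKn.
have sz : size (pmap (@fetch_of G) segment) + size (pmap (@store_of G) segment)
    = count (@is_transfer G) segment.
  by elim: segment => //= -[] u l /= <- //; rewrite ?addSn ?addnS.
apply: (@leq_trans (#|(config_at s).1| + size (pmap (@fetch_of G) segment) +
    size (pmap (@store_of G) segment))); last by rewrite -addnA sz.
apply: leq_add; last by rewrite cardsE card_size.
apply: leq_trans (leq_card_setU _ _) _.
by rewrite leq_add2l cardsE card_size.
Qed.

Lemma computed_available t u : s <= t < e -> move_at t = Comp u ->
  u \in available.
Proof.
clear ms_play.
move=> te mu; rewrite !inE; apply/orP; right; apply/mem_segmentP.
by exists t => //; rewrite mu.
Qed.

Lemma cache_available t : s <= t <= e -> (config_at t).1 \subset available.
Proof.
elim: t => [|t IH] te.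
  have -> : 0 = s by lia.
  by apply/fintype.subsetP => u us; rewrite !inE us.
have [lt|st] := ltnP t s.
  have -> : t.+1 = s by lia.
  by apply/fintype.subsetP => u us; rewrite !inE us.
have tL : t < size ms by lia.
have te' : s <= t < e by lia.
have IHt : (config_at t).1 \subset available by apply: IH; lia.
rewrite config_atS //; case E : (move_at t) => [u|u|u|u] //=.
- by rewrite finset.subUset IHt finset.sub1set (computed_available te' E).
- rewrite finset.subUset IHt finset.sub1set andbT !inE.
  apply/orP; left; apply/orP; right; apply/mem_segmentP.
  by exists t => //; rewrite E.
- by apply: fintype.subset_trans IHt; exact: finset.subsetDl.
Qed.

Lemma available_closed u : u \in available -> u \notin sources ->
  ~~ is_input u /\ preds u \subset available.
Proof.
rewrite finset.in_setU => /orP[->//|]; rewrite inE => /mem_segmentP[t te].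
case E : (move_at t) => [w|||] //= [wu] _; rewrite {w}wu in E.
have tL : t < size ms by lia.
have := admissible_at tL; rewrite E => /andP[/andP[-> pu] _]; split=> //.
apply: fintype.subset_trans pu _; apply: cache_available; lia.
Qed.

End Segment.

Lemma slow_growth t e u : t <= e -> e <= size ms ->
  u \notin (config_at t).2 -> u \in (config_at e).2 ->
  exists2 t', t <= t' < e & move_at t' = Store u.
Proof.
clear ms_play.
move=> te eL ut; elim: e te eL => [|e IH] te eL.
  have -> : 0 = t by lia.
  by rewrite (negbTE ut).
have [<-|ne] := eqVneq t e.+1; first by rewrite (negbTE ut).
have [ue _|ue] := boolP (u \in (config_at e).2).
  have [|||t' t'e E] := IH => //; try lia.
  by exists t' => //; lia.
rewrite config_atS //; case E : (move_at e) => [w|w|w|w] /=;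
  rewrite ?(negbTE ue) // !inE (negbTE ue) orbF => /eqP uw.
by exists e; [lia | rewrite E uw].
Qed.

(** * The last absence of a leaf *)

Section Presence.
Variables (A : {set G}) (l r : G).
Hypotheses (lA : l \in A) (lr : connect (tree_edge A) l r).
Hypotheses (c0A : {in A, forall x, x \notin c0.1 :|: c0.2}).
Hypothesis r_comp : r \in pmap (@comp_of G) ms.

(** When [A] is a tree with root [r], each vertex other than [r] has a single parent, so the
    vertices reachable from [l] are exactly those on its path to [r]. *)
Definition present t :=
  (r \in pmap (@comp_of G) (take t ms)) ||
  [exists x, connect (tree_edge A) l x &&
     (x \in (config_at t).1 :|: (config_at t).2)].

(* A vertex above [l] other than [l] itself can only be computed from another
   vertex above [l]. *)
Lemma presence_starts t : t < size ms ->
  ~~ present t -> present t.+1 -> move_at t = Comp l.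
Proof.
move=> tL nt; have /norP[nr /existsPn nx] := nt.
have nxP x : connect (tree_edge A) l x ->
    x \notin (config_at t).1 /\ x \notin (config_at t).2.
  by move=> lx; move: (nx x); rewrite lx finset.in_setU => /norP.
have compE x : connect (tree_edge A) l x -> move_at t = Comp x ->
    move_at t = Comp l.
  move=> lx E; have := admissible_at tL; rewrite E => /andP[/andP[_ px] _].
  have [->//|ne] := eqVneq x l.
  case/connectP: lx => p; case/lastP: p => [_ xl|p y]; first by rewrite xl eqxx in ne.
  rewrite rcons_path last_rcons => /andP[lp ey] xy; rewrite -{y}xy in ey.
  have /nxP[/negP[]] : connect (tree_edge A) l (last l p) by apply/connectP; exists p.
  apply: (fintype.subsetP px); rewrite inE; by case/and3P: ey.
rewrite /present; case/orP.
  rewrite (take_nth (Drop x0)) // -cats1 pmap_cat mem_cat (negbTE nr) /=.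
  rewrite -/(move_at t); case E : (move_at t) => [w|||] //=.
  by rewrite inE => /eqP rw; rewrite -E; apply: (compE r) => //; rewrite rw.
case/existsP => x /andP[lx]; have [n1 n2] := nxP x lx.
have := admissible_at tL; rewrite config_atS //.
case E : (move_at t) => [w|w|w|w]; rewrite !inE ?(negbTE n1) ?(negbTE n2) /= ?orbF.
- by move=> _ /eqP xw; rewrite -E; apply: (compE x) => //; rewrite xw.
- by case/andP=> wL _ /eqP xw; rewrite xw wL in n2.
- by case/andP=> wC _ /eqP xw; rewrite xw wC in n1.
- by rewrite andbF.
Qed.

(** Absence holds at time 0, when neither memory meets [A], and fails at the end, when [r] has been
    computed. Taking the last absent time makes recomputation harmless: each leaf is attributed
    once, and its path stays marked ever after. *)
Lemma last_absence : exists t, [/\ t < size ms, move_at t = Comp l,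
  ~~ present t & forall e, t < e <= size ms -> present e].
Proof.
have n0 : ~~ present 0.
  apply/norP; split; first by rewrite take0.
  apply/existsPn => x; apply/negP => /andP[/(tree_up lA)/c0A /negP xc].
  by rewrite /config_at take0.
have ex : exists t, (t <= size ms) && ~~ present t by exists 0.
have ub t : (t <= size ms) && ~~ present t -> t <= size ms by case/andP.
case: (ex_maxnP ex ub) => t /andP[tL nt] tmax.
have pL : present (size ms) by rewrite /present take_size r_comp.
have later e : t < e <= size ms -> present e.
  move=> /andP[te eL]; apply/negPn/negP => ne.
  by have := tmax e; rewrite eL ne; lia.
have tL' : t < size ms.
  rewrite ltn_neqAle tL andbT; apply/eqP => tE; by rewrite tE pL in nt.
exists t; split=> //; apply: presence_starts => //.
by apply: later; rewrite leqnn.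
Qed.

(** Slow memory only grows, so a path vertex found there at [e] but missing at [t] was stored in
    between. The trace is thus always due to the interval itself or to the cache at its end. *)
Lemma presence_trace t e : t < e <= size ms -> ~~ present t -> present e ->
  (exists2 t', t <= t' < e & move_at t' = Comp r) \/
  exists2 x, x \in A & x \in (config_at e).1 \/
    exists2 t', t <= t' < e & move_at t' = Store x.
Proof.
move=> /andP[te eL] /norP[nr /existsPn nx] /orP[].
  rewrite -(cat_take_drop t (take e ms)) pmap_cat mem_cat take_takel 1?ltnW //.
  rewrite (negbTE nr) /= => /mem_segmentP [|//|t' t'e]; first exact: ltnW.
  by case E : (move_at t') => [w|||] //= [<-]; left; exists t'.
case/existsP => x /andP[lx]; rewrite finset.in_setU => /orP[xC|xL]; right.
  by exists x; [exact: tree_up lx | left].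
exists x; [exact: tree_up lx | right].
apply: slow_growth => //; first exact: ltnW.
by move: (nx x); rewrite lx finset.in_setU => /norP[].
Qed.

End Presence.
End Play.

(** * Arithmetic of one segment, and the number of wide leaves *)

(** [x ^ 2 <= c * (a * b) <= 4 * M * (a * b) <= M * (a + b) ^ 2], the last step being the inequality
    of the arithmetic and geometric means. *)
Lemma geometric_mean_bound (R : realType) (M a b c x : nat) :
  x <= c -> x <= a * b -> c <= 4 * M ->
  (x%:R <= Num.sqrt M%:R * (a + b)%:R :> R)%R.
Proof.
move=> xc xab cM.
have xx : x ^ 2 <= M * (a + b) ^ 2.
  apply: (@leq_trans (4 * M * (a * b))).
    by rewrite expnS expn1 leq_mul // (leq_trans xc).
  rewrite -mulnA mulnCA leq_mul2l; apply/orP; right.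
  exact: nat_AGM2.
rewrite -[leLHS]ger0_norm ?ler0n // -sqrtr_sqr.
rewrite -[X in (_ <= _ * X)%R]ger0_norm ?ler0n // -sqrtr_sqr -sqrtrM ?ler0n //.
by apply: ler_wsqrtr; rewrite -!natrX -natrM ler_nat.
Qed.

Section WideTriples.
Variables n M : nat.
Let I := 'I_n.+1.

(* The triple ((i, j), m) stands for the leaf of [T i j] whose predecessors are
   [v i m] and [v m.+1 j]. *)
Definition wide_triple (p : (I * I) * I) : bool :=
  [&& 1 <= p.1.1, p.1.1 + 3 * M <= p.2 & p.2.+1 + 3 * M <= p.1.2].

Lemma wide_tripleE (p : (I * I) * I) : wide_triple p ->
  [/\ 1 <= p.1.1, p.1.1 < p.1.2, p.1.2 <= n & p.2 - p.1.1 < p.1.2 - p.1.1].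
Proof.
by case/and3P=> h1 h2 h3; split; rewrite -1?ltnS ?ltn_ord //; lia.
Qed.

Lemma card_wide_triples N : n = N + 6 * M + 1 ->
  N ^ 3 <= 6 * #|[set p : (I * I) * I | wide_triple p]%SET|.
Proof.
case: N => [//|N] nN.
pose x (t : 3.-tuple 'I_N.+1) k : nat := nth ord0 t k.
(* Shifting the entries of a nondecreasing triple by 0, 3M and 6M (plus offsets 1, 1, 2) turns
   sortedness into wideness. *)
pose f t : (I * I) * I :=
  ((inord (x t 0).+1, inord (x t 2 + 6 * M).+2), inord (x t 1 + 3 * M).+1).
have xN t k : x t k <= N by rewrite /x -ltnS ltn_ord.
pose P := [set t : 3.-tuple 'I_N.+1 | sorted leq (map val t)]%SET.
have f_inj : {in P &, injective f}.
  move=> t t' _ _ [] /(congr1 val) + /(congr1 val) + /(congr1 val).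
  have := (xN t 0, xN t 1, xN t 2, xN t' 0, xN t' 1, xN t' 2).
  case=> [[[[[h0 h1] h2] h0'] h1'] h2'].
  rewrite /= !inordK; try by move: nN; lia.
  move=> e0 e2 e1; apply/val_inj/(@eq_from_nth _ ord0); first by rewrite !size_tuple.
  move=> [|[|[|k]]]; rewrite size_tuple // => _; apply/val_inj => /=.
  - by move: e0; rewrite /x; lia.
  - by move: e1; rewrite /x; lia.
  - by move: e2; rewrite /x; lia.
have Pcard : #|P| <= #|[set p : (I * I) * I | wide_triple p]%SET|.
  rewrite -(card_in_imset f_inj); apply: subset_leq_card.
  apply/fintype.subsetP => _ /imsetP[t tP ->]; rewrite inE /wide_triple /f /=.
  have [x01 x12] : x t 0 <= x t 1 /\ x t 1 <= x t 2.
    move: tP; rewrite inE /x; case: t => [[|y0 [|y1 [|y2 [|? ?]]]] //= _].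
    by case/and3P.
  have := (xN t 0, xN t 1, xN t 2) => -[[h0 h1] h2].
  by rewrite !inordK; move: nN; lia.
apply: leq_trans (leq_mul (leqnn 6) Pcard).
(* Six times this binomial coefficient is (N + 1)(N + 2)(N + 3), at least the cube of N + 1, where
   [N] is by now the predecessor of the original one. *)
rewrite card_sorted_tuples mulnC (bin_ffact (3 + N) 3) !ffactnS ffactn0.
by rewrite /= !expnS expn0; nia.
Qed.

End WideTriples.

(** * Leaves attributed to a segment, and the total number of transfers *)

Section Bound.
Variables (n M : nat) (G : cdag) (v : nat -> nat -> G).
Variables (T : nat -> nat -> {set G}) (leaf : nat -> nat -> nat -> G).
Hypothesis F : family_labelling n v T leaf.
Hypothesis M0 : 0 < M.
Variable ms : seq (move G).
Let x0 := v 1 1.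
Let c0 : config G := (finset.set0, [set u | is_input u]%SET).
Hypothesis ms_play : play M c0 ms.
Hypothesis ms_comp : forall u, ~~ is_input u -> u \in pmap (@comp_of G) ms.

Let c0M : #|c0.1| <= M.
Proof. by rewrite cards0. Qed.

Let I := 'I_n.+1.

Definition triple_leaf (p : (I * I) * I) : G :=
  leaf p.1.1 p.1.2 (p.2 - p.1.1).

Definition leaf_present (p : (I * I) * I) (t : nat) : bool :=
  present c0 ms (T p.1.1 p.1.2) (triple_leaf p) (v p.1.1 p.1.2) t.

Definition produced_at (p : (I * I) * I) (t : nat) : Prop :=
  [/\ t < size ms, move_at x0 ms t = Comp (triple_leaf p),
    ~~ leaf_present p t & forall e, t < e <= size ms -> leaf_present p e].

Lemma triple_produced p : wide_triple M p -> exists t, produced_at p t.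
Proof.
move=> /wide_tripleE[i1 ij jn kj].
have lT := leaf_in_tree F i1 ij jn kj.
apply: (last_absence x0 ms_play lT).
- exact: (bt_connect (fl_tree F i1 ij jn) lT).
- move=> x /(fl_tree_input F i1 ij jn); by rewrite !inE.
- apply: ms_comp; apply: (fl_tree_input F i1 ij jn).
  exact: bt_root (fl_tree F i1 ij jn).
Qed.

Section Segment.
Variables s e : nat.
Hypotheses (se : s <= e) (eL : e <= size ms).
Hypothesis seM : transfers ms e <= transfers ms s + 2 * M.

Let D := sources c0 ms s e.
Let Av := available c0 ms s e.
Let St := stored ms s e.

Let DSt : #|D| + #|St| <= 3 * M.
Proof.
have := card_sources_stored c0 ms se; rewrite -/D -/St.
by have := card_cache_at x0 ms_play c0M (leq_trans se eL); move: seM; lia.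
Qed.

Definition available_pair i j :=
  [&& 1 <= i, i + 3 * M <= j, j <= n & v i j \in Av].

Lemma available_pair_meets i j : available_pair i j ->
  exists2 x, x \in D & x \in T i j.
Proof.
case/and4P=> i1 ij jn vA.
apply: (wide_tree_meets F (available_closed x0 ms_play se eL)) vA => //.
  by move: M0 ij; lia.
by rewrite -/D; move: DSt ij; lia.
Qed.

(** [f] is the identity for the left predecessors [(i, m)] and the successor for the right ones
    [(m + 1, j)], so that both are indexed by the same [m]. *)
Lemma card_available_pairs (f : nat -> nat) : injective f ->
  #|[set p : I * I | available_pair (f p.1) p.2]%SET| <= 3 * M.
Proof.
move=> f_inj; apply: (@leq_trans #|D|); last by move: DSt; lia.
pose r (p : I * I) x := [/\ 1 <= f p.1, f p.1 < p.2 & x \in T (f p.1) p.2].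
apply: (leq_card_rel (r := r)).
  move=> [i j]; rewrite inE /= => ap.
  have [x xD xT] := available_pair_meets ap; exists x => //; split=> //.
    by case/and4P: ap.
  by case/and4P: ap; move: M0 => /=; lia.
move=> [i j] [i' j'] x [/= i1 ij xT] [/= i1' ij' xT'].
have jn : j <= n by rewrite -ltnS.
have jn' : j' <= n by rewrite -ltnS.
have [/f_inj ii' jj'] := tree_inj F i1 ij jn i1' ij' jn' xT xT'.
by congr pair; apply/val_inj.
Qed.

Variable S : {set (I * I) * I}.
Hypothesis S_wide : {in S, forall p, wide_triple M p}.
Hypothesis S_produced :
  {in S, forall p, exists2 t, s <= t < e & produced_at p t}.

Lemma produced_available p : p \in S ->
  available_pair p.1.1 p.2 /\ available_pair p.2.+1 p.1.2.
Proof.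
move=> pS; have pw := S_wide pS.
have [i1 ij jn kj] := wide_tripleE pw.
have [t te [tL tl _ _]] := S_produced pS.
have : preds (triple_leaf p) \subset Av.
  have := admissible_at x0 ms_play tL; rewrite tl => /andP[/andP[_ pl] _].
  apply: fintype.subset_trans pl _; apply: cache_available => //; lia.
rewrite (fl_leaf_preds F i1 ij jn kj) finset.subUset !finset.sub1set.
case/and3P: pw => _ im mj.
rewrite (subnKC (leq_trans (leq_addr _ _) im)) addn1 => /andP[a1 a2].
have mn : p.2 <= n by rewrite -ltnS.
by split; apply/and4P; split.
Qed.

(* An unfinished tree leaves a vertex in the cache or in slow memory at the end
   of the segment; a finished one is wide, hence meets [D]. *)
Lemma card_touched_trees :
  #|[set q : I * I | [exists m, (q, m) \in S]]%SET| <= 4 * M.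
Proof.
(* [D] and [St] together have at most 3M elements, and the final cache adds M. *)
apply: (@leq_trans #|D :|: St :|: (config_at c0 ms e).1|); last first.
  apply: leq_trans (leq_card_setU _ _) _.
  have DSt' : #|D :|: St| <= #|D| + #|St| by apply: leq_card_setU.
  apply: leq_trans (leq_add DSt' (card_cache_at x0 ms_play c0M eL)) _.
  by move: DSt; lia.
pose r (q : I * I) x := [/\ 1 <= q.1, q.1 < q.2 & x \in T q.1 q.2].
apply: (leq_card_rel (r := r)).
  move=> q; rewrite inE => /existsP[m qS].
  have [i1 ij jn kj] := wide_tripleE (S_wide qS).
  have [t te [tL _ nt pt]] := S_produced qS.
  have lT := leaf_in_tree F i1 ij jn kj.
  have te' : t < e <= size ms by rewrite eL andbT; case/andP: te.
  have [[t' t'e vt']|[x xT]] := presence_trace x0 lT te' nt (pt e te').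
    have st'e : s <= t' < e by lia.
    have [|x xD xT] := @available_pair_meets q.1 q.2.
      apply/and4P; split=> //; last exact: (computed_available c0 se eL st'e vt').
      case/and3P: (S_wide qS) => /= _ im mj.
      by apply: leq_trans im (leq_trans _ mj); rewrite ltnW // leq_addr.
    by exists x => //; rewrite 2!finset.in_setU xD.
  case=> [xC|[t' t'e xt']]; exists x => //;
    rewrite 2!finset.in_setU; apply/orP; first by right.
  left; apply/orP; right; rewrite inE; apply/(mem_segmentP x0 se eL).
  by exists t'; [lia | rewrite xt'].
move=> [i j] [i' j'] x [/= i1 ij xT] [/= i1' ij' xT'].
have jn : j <= n by rewrite -ltnS.
have jn' : j' <= n by rewrite -ltnS.
have [ii' jj'] := tree_inj F i1 ij jn i1' ij' jn' xT xT'.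
by congr pair; apply/val_inj.
Qed.

Lemma card_segment (R : realType) :
  (#|S|%:R <= 6%:R * M%:R * Num.sqrt M%:R :> R)%R.
Proof.
pose a (m : I) := #|[set i : I | available_pair i m]%SET|.
pose b (m : I) := #|[set j : I | available_pair m.+1 j]%SET|.
pose Sm m := [set q : I * I | (q, m) \in S]%SET.
have SE : #|S| = \sum_m #|Sm m|.
  rewrite /Sm -card_pairs_sum; apply: eq_card => -[q m]; by rewrite inE.
have suma : \sum_m a m <= 3 * M.
  rewrite /a -(card_pairs_sum (fun i m : I => available_pair i m)).
  exact: (card_available_pairs (f := id)).
have sumb : \sum_m b m <= 3 * M.
  rewrite /b -(card_pairs_sum (fun j m : I => available_pair m.+1 j)).
  apply: leq_trans (card_available_pairs succn_inj).
  (* [card_pairs_sum] groups by the second component, whereas here [m] is the first one. *)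
  have sw_inj : injective (fun p : I * I => (p.2, p.1)) by move=> [? ?] [? ?] [-> ->].
  rewrite -(card_imset _ sw_inj); apply: subset_leq_card.
  by apply/fintype.subsetP => _ /imsetP[p pA ->]; move: pA; rewrite !inE.
apply: (@le_trans _ _ (\sum_m (Num.sqrt M%:R * (a m + b m)%:R))%R).
  rewrite SE natr_sum; apply: ler_sum => m _.
  apply: (@geometric_mean_bound R M (a m) (b m)
    #|[set q : I * I | [exists m, (q, m) \in S]]%SET|) card_touched_trees.
    apply: subset_leq_card; apply/fintype.subsetP => q; rewrite !inE => qS.
    by apply/existsP; exists m.
  rewrite -cardsX; apply: subset_leq_card; apply/fintype.subsetP => -[i j].
  by rewrite !inE => /produced_available /= [-> ->].
rewrite -mulr_sumr mulrC ler_wpM2r ?sqrtr_ge0 // -natr_sum -natrM ler_nat.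
by rewrite big_split /= -[6]/(3 + 3) mulnDl leq_add.
Qed.

End Segment.

(** Each induction step cuts off a segment with exactly 2M transfers; the segment left at the end
    has at most 2M. *)
Lemma card_wide_produced_after (R : realType) (tm : (I * I) * I -> nat) (q s : nat) :
  (forall p, wide_triple M p -> produced_at p (tm p)) ->
  s <= size ms -> transfers ms (size ms) <= transfers ms s + 2 * M * q.+1 ->
  (#|[set p : (I * I) * I | wide_triple M p && (s <= tm p)%N]%SET|%:R
    <= 6%:R * M%:R * Num.sqrt M%:R * q.+1%:R :> R)%R.
Proof.
move=> tmP; elim: q s => [|q IH] s sL sq.
  rewrite mulr1; apply: (@card_segment s (size ms)) => //.
  - by move: sq; rewrite muln1.
  - by move=> p; rewrite inE => /andP[].
  - move=> p; rewrite inE => /andP[pw st]; have pt := tmP p pw.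
    by exists (tm p) => //; rewrite st; case: pt.
have [le|gt] := leqP (transfers ms (size ms)) (transfers ms s + 2 * M * q.+1).
  apply: le_trans (IH s sL le) _; apply: ler_wpM2l; last by rewrite ler_nat.
  by rewrite !mulr_ge0 ?sqrtr_ge0 ?ler0n.
have [|e /andP[ls eL] eq2] := transfers_onto x0 sL (k := transfers ms s + 2 * M).
  by move: gt; rewrite mulnS; lia.
have IHe : transfers ms (size ms) <= transfers ms e + 2 * M * q.+1.
  by rewrite eq2 -addnA -mulnS.
rewrite -[q.+2]add1n natrD mulrDr mulr1.
pose S1 := [set p : (I * I) * I | wide_triple M p && (s <= tm p < e)]%SET.
pose S2 := [set p : (I * I) * I | wide_triple M p && (e <= tm p)]%SET.
apply: (@le_trans _ _ (#|S1|%:R + #|S2|%:R)%R); last first.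
  apply: lerD; last exact: IH.
  apply: (@card_segment s e) => //.
  - by rewrite eq2.
  - by move=> p; rewrite inE => /andP[].
  - by move=> p; rewrite inE => /andP[pw st]; exists (tm p) => //; exact: tmP.
rewrite -natrD ler_nat; apply: leq_trans (leq_card_setU _ _).
apply: subset_leq_card; apply/fintype.subsetP => p; rewrite !inE.
by case/andP=> -> ->; case: ltnP.
Qed.

(** With [K] transfers, [K %/ (2 * M) + 1] segments suffice. The additional segment causes the term
    2M. *)
Lemma transfers_wide (R : realType) :
  (#|[set p : (I * I) * I | wide_triple M p]%SET|%:R
    <= 3%:R * Num.sqrt M%:R * ((transfers ms (size ms))%:R + 2%:R * M%:R) :> R)%R.
Proof.
have ex p : exists t, wide_triple M p -> produced_at p t.
  case: (boolP (wide_triple M p)) => [/triple_produced[t pt]|_]; last by exists 0.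
  by exists t.
have [tm tmP] := boolp.choice ex.
set K := transfers ms (size ms); pose q := K %/ (2 * M).
have := @card_wide_produced_after R tm q 0 tmP (leq0n _).
have -> : [set p : (I * I) * I | wide_triple M p && (0 <= tm p)]%SET =
    [set p : (I * I) * I | wide_triple M p]%SET.
  by apply/setP => p; rewrite !inE andbT.
rewrite -/K => h; apply: le_trans (h _) _.
  by rewrite {1}/transfers take0 /= add0n mulnC ltnW // ltn_ceil // muln_gt0.
have qK : ((2 * M * q)%:R <= K%:R :> R)%R by rewrite ler_nat mulnC leq_trunc_div.
have s0 : (0 <= Num.sqrt M%:R :> R)%R by rewrite sqrtr_ge0.
have -> : (6%:R * M%:R * Num.sqrt M%:R * q.+1%:R =
    3%:R * Num.sqrt M%:R * ((2 * M * q)%:R + 2%:R * M%:R) :> R)%R.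
  by rewrite -natr1 !natrM; ring.
by rewrite ler_wpM2l ?mulr_ge0 // lerD2r.
Qed.

(** The whole play is taken as one segment. The cache starts empty, so [D] consists of fetched
    values; every input precedes a computed leaf, hence is available, and cannot be computed, hence
    lies in [D]. *)
Lemma transfers_inputs : 1 < n -> n <= transfers ms (size ms).
Proof.
clear M0; move=> n1; have L0 := leq0n (size ms); have LL := leqnn (size ms).
set D := sources c0 ms 0 (size ms); set Av := available c0 ms 0 (size ms).
have avP := available_closed x0 ms_play L0 LL; rewrite -/D -/Av in avP.
have DT : #|D| <= transfers ms (size ms).
  have := card_sources_stored c0 ms L0; rewrite -/D /config_at take0 cards0.
  by rewrite /transfers take0; lia.
have leafA i j k : 1 <= i -> i < j -> j <= n -> k < j - i ->
    v i (i + k) \in Av /\ v (i + k + 1) j \in Av.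
  move=> i1 ij jn kj.
  have lT := leaf_in_tree F i1 ij jn kj.
  have lin := fl_tree_input F i1 ij jn lT.
  have := fl_leaf_preds F i1 ij jn kj.
  have /mem_segmentP -/(_ x0 L0 LL)[t tL] : leaf i j k \in
      pmap (@comp_of G) (segment ms 0 (size ms)).
    by rewrite /segment drop0 take_size ms_comp.
  case E : (move_at x0 ms t) => [w|||] //= [wl]; rewrite {w}wl in E.
  have := admissible_at x0 ms_play tL; rewrite E => /andP[/andP[_ pl] _].
  move=> pE; move: (fintype.subset_trans pl
    (cache_available x0 ms_play L0 LL (introT andP (conj (leq0n t) (ltnW tL))))).
  by rewrite pE finset.subUset !finset.sub1set => /andP.
apply: leq_trans DT; rewrite -[n in n <= _]card_ord -cardsT.
apply: (leq_card_rel (r := fun o : 'I_n => eq^~ (v o.+1 o.+1))); last first.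
  move=> o o' d -> /(fl_input_inj F) E; apply/val_inj/succn_inj; apply: E => //=.
move=> o _; exists (v o.+1 o.+1) => //.
have on := ltn_ord o.
apply: (input_available F avP) => //=.
(* An input other than the last precedes leaf 0 of the tree of [(o + 1, n)]; the last one precedes
   leaf [n - 2] of the tree of [(1, n)]. *)
have [lt|ge] := ltnP o.+1 n.
  have k0 : 0 < n - o.+1 by lia.
  by have [] := leafA o.+1 n 0 (ltn0Sn o) lt (leqnn n) k0; rewrite addn0.
have k0 : n - 2 < n - 1 by lia.
have [_] := leafA 1 n (n - 2) isT n1 (leqnn n) k0.
have -> : 1 + (n - 2) + 1 = n by lia.
by have -> : o.+1 = n by lia.
Qed.

End Bound.

(** * From transfers back to I/O operations *)

Local Open Scope ring_scope.

Lemma schedule_bound (R : realType) (n M B : nat) (G : cdag)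
    (mem0 : slow_memory G) (ops : seq (op G)) :
  (1 < n)%N -> (0 < M)%N -> (0 < B)%N -> in_family n G ->
  is_schedule M B mem0 ops ->
  Num.max ((n%:R - 6%:R * M%:R - 1) ^+ 3 / (18%:R * Num.sqrt M%:R)
             - 2%:R * M%:R)
            n%:R / B%:R <= (io_count ops)%:R :> R.
Proof.
move=> n1 M0 B0 [v [T [leaf F]]] [[mem0P _] run comp].
have [||ms [ms_play ms_comp ms_io]] :=
    play_of_run (L := [set u | is_input u]%SET) run.
- by move=> x u /mem0P; rewrite inE.
- by rewrite cards0.
rewrite -ms_comp in comp.
have io_le : (transfers ms (size ms) <= io_count ops * B)%N.
  by rewrite /transfers take_size mulnC.
rewrite ler_pdivrMr ?ltr0n // ge_max.
apply/andP; split; last first.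
  rewrite -natrM ler_nat; apply: leq_trans io_le.
  exact: (transfers_inputs F ms_play comp n1).
have s0 : 0 < Num.sqrt M%:R :> R by rewrite sqrtr_gt0 ltr0n.
rewrite lerBlDr ler_pdivrMr ?mulr_gt0 ?ltr0n //.
set K := (transfers ms (size ms)) in io_le.
(* The constant 18 is 6, from counting wide triples, times 3, from [transfers_wide]. *)
apply: (@le_trans _ _ (6%:R * (3%:R * Num.sqrt M%:R * (K%:R + 2%:R * M%:R)))); last first.
  have -> : 6%:R * (3%:R * Num.sqrt M%:R * (K%:R + 2%:R * M%:R)) =
      (K%:R + 2%:R * M%:R) * (18%:R * Num.sqrt M%:R) :> R by ring.
  by rewrite ler_wpM2r ?mulr_ge0 ?ler0n ?(ltW s0) // lerD2r -natrM ler_nat.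
(* In the first case the cubed quantity is nonpositive and the bound is trivial; otherwise it is a
   natural number [N]. *)
have [small|large] := ltnP n (6 * M + 1).
  apply: (@le_trans _ _ 0); last first.
    by rewrite !mulr_ge0 ?addr_ge0 ?mulr_ge0 ?ler0n ?(ltW s0).
  have N0 : n%:R - 6%:R * M%:R - 1 <= 0 :> R.
    move: (ltnW small); rewrite -(ler_nat R) natrD natrM; lra.
  by rewrite exprSr mulr_ge0_le0 ?sqr_ge0.
have nN : n = (n - (6 * M + 1) + 6 * M + 1)%N by lia.
have := card_wide_triples nN; set N := (n - _)%N in nN *.
have -> : n%:R - 6%:R * M%:R - 1 = N%:R :> R by rewrite nN 2!natrD natrM; ring.
rewrite -(ler_nat R) natrX => h; apply: le_trans h _.
rewrite natrM ler_wpM2l ?ler0n //.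
exact: (transfers_wide F M0 ms_play comp R).
Qed.

Theorem theorem6 (R : realType) (n M B a b : nat) (G : cdag)
  (ha : (3 <= a)%N) (hb : (3 <= b)%N)
  (hn : n = (2 ^ a)%N) (hM : M = (2 ^ b)%N) (hB : (1 <= B)%N)
  (hG : in_family n G) :
  let bound : R :=
    Num.max ((n%:R - 6%:R * M%:R - 1) ^+ 3 / (18%:R * Num.sqrt M%:R)
             - 2%:R * M%:R)
            n%:R / B%:R in
  (forall (mem0 : slow_memory G) (ops : seq (op G)),
     is_schedule M B mem0 ops -> bound <= (io_count ops)%:R) /\
  (bound%:E <= IO R G M B)%E.
Proof.
have n1 : (1 < n)%N by rewrite hn -[1%N](expn0 2) ltn_exp2l // (leq_trans _ ha).
have M0 : (0 < M)%N by rewrite hM expn_gt0.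
move=> bound; have sched mem0 ops := @schedule_bound R n M B G mem0 ops n1 M0 hB hG.
split=> [//|]; apply: le_ereal_inf_tmp => _ [mem0 [ops [ops_sched ->]]].
by rewrite lee_fin; exact: sched ops_sched.
Qed.
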